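(* Let $n\ge 2$ be an integer, let $Q=[w_0,\dots,w_{n-1}]$ be the canonical cycle basis matrix of order $n$, and let $S_j(k)$, $c_n$, $\Delta_n$ and $\delta_n$ be as defined in the context. Choose indices $1\le j^{\ast}\le n-1$ and $0\le k^{\ast}\le n-1$ with $S_{j^{\ast}}(k^{\ast})^2=c_n$. Let $t<0$ be real, let $\lambda_{j^{\ast}}=t$ and $\lambda_j=0$ for all $j\in\{1,\dots,n-1\}\setminus\{j^{\ast}\}$, let $\Lambda=\operatorname{diag}(1,\lambda_1,\dots,\lambda_{n-1})$ and $P(\Lambda)=Q\Lambda Q^{\top}=(p_{kl})_{0\le k,l\le n-1}$. Then \[ p_{k^{\ast}k^{\ast}}=\frac1n\bigl(1+2t\cos^2\Delta_n\bigr), \] which is non-negative if and only if $t\ge -1/(2\cos^2\Delta_n)$, i.e. if and only if $1+\sum_{j=1}^{n-1}\lambda_j\ge\delta_n$. Thus the threshold $\delta_n$ is optimal for this $Q$ among conditions depending only on the sum: for every real $s<\delta_n$ there are real numbers $\lambda_1,\dots,\lambda_{n-1}\le 0$ with $1+\sum_{j=1}^{n-1}\lambda_j=s$ for which $Q\operatorname{diag}(1,\lambda_1,\dots,\lambda_{n-1})Q^{\top}$ has a negative entry.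
   Context: The canonical cycle basis matrix of order $n$ is the real orthogonal matrix $Q=[w_0,\dots,w_{n-1}]$ whose columns (with coordinates indexed by $0,\dots,n-1$) are $w_0=\mathbf 1/\sqrt n$, where $\mathbf 1$ is the all-ones vector, and, for $1\le j\le n-1$, $w_j(k)=\sqrt{\tfrac2n}\,S_j(k)$ with $S_j(k):=\sin\!\big(\tfrac{2\pi jk}{n}+\tfrac{\pi}{4}\big)$, $0\le k\le n-1$. Further, \[ c_n:=\max_{1\le j\le n-1}\ \max_{0\le k,l\le n-1}S_j(k)S_j(l),\qquad \Delta_n:=\min_{m,t\in\mathbb Z}\left|\frac{2\pi m}{n}-\frac{(2t+1)\pi}{4}\right|,\qquad \delta_n:=1-\frac{1}{2\cos^2\Delta_n}. \] (The maximum defining $c_n$ is attained with $k=l$, so indices $j^{\ast},k^{\ast}$ as in the claim exist.) *)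

(* Defs.v *)
From mathcomp Require Import all_boot all_order all_algebra.
From mathcomp Require Import all_classical all_reals all_analysis.
From mathcomp Require Import ring lra.

Set Implicit Arguments.
Unset Strict Implicit.
Unset Printing Implicit Defensive.

Import Order.TTheory GRing.Theory Num.Theory.
Local Open Scope classical_set_scope.
Local Open Scope ring_scope.

Section CanonicalCycleBasis.
Variables (R : realType) (n : nat).

Definition cycleS (j k : nat) : R :=
  sin (2 * pi * j%:R * k%:R / n%:R + pi / 4).

(* Columns are the basis vectors: entry (k, j) is w_j(k). *)
Definition cycleQ : 'M[R]_n :=
  \matrix_(k < n, j < n)
    if j == 0%N :> nat then (Num.sqrt n%:R)^-1
    else Num.sqrt (2 / n%:R) * cycleS j k.

Definition cycle_products : set R :=
  [set x | exists j k l : nat,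
     [/\ (1 <= j < n)%N, (k < n)%N, (l < n)%N & x = cycleS j k * cycleS j l]].

(* For 2 <= n the supremum is a maximum: [cycle_c_max]. *)
Definition cycle_c : R := sup cycle_products.

Definition cycle_gaps : set R :=
  [set x | exists m t : int,
     x = `|2 * pi * m%:~R / n%:R - (2 * t + 1)%:~R * pi / 4|].

(* For 1 <= n the infimum is a minimum: [cycle_Delta_min]. *)
Definition cycle_Delta : R := inf cycle_gaps.

Definition cycle_delta : R := 1 - 1 / (2 * cos cycle_Delta ^+ 2).

(* diag(1, lam_1, ..., lam_(n-1)); the values of [lam] outside {1, ..., n-1}
   are never used. *)
Definition cycle_Lambda (lam : nat -> R) : 'M[R]_n :=
  diag_mx (\row_(j < n) if j == 0%N :> nat then 1 else lam j).

Definition cycleP (lam : nat -> R) : 'M[R]_n :=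
  cycleQ *m cycle_Lambda lam *m cycleQ^T.

Lemma cycle_c_max : (2 <= n)%N ->
  cycle_products cycle_c /\ ubound cycle_products cycle_c.
Proof.
move=> n2.
pose F (i : 'I_n * 'I_n * 'I_n) : R :=
  cycleS i.1.1 i.1.2 * cycleS i.1.1 i.2.
have n0 : (0 < n)%N by exact: ltnW.
pose i0 := (Ordinal n2, Ordinal n0, Ordinal n0).
case: (@arg_maxP _ _ _ i0 (fun i => (1 <= i.1.1)%N) F isT) => i i1 imax.
have Mi : cycle_products (F i).
  by exists i.1.1, i.1.2, i.2; rewrite i1 !ltn_ord.
have Ui : ubound cycle_products (F i).
  move=> _ [j [k [l [/andP[j1 jn] kn ln ->]]]].
  exact: (imax (Ordinal jn, Ordinal kn, Ordinal ln)).
suff -> : cycle_c = F i by [].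
apply/eqP; rewrite eq_le; apply/andP; split.
  by apply: ge_sup => //; exists (F i).
by apply: ub_le_sup => //; exists (F i).
Qed.

Lemma cycle_c_diag : (2 <= n)%N -> exists j k : nat,
  [/\ (1 <= j < n)%N, (k < n)%N & cycleS j k ^+ 2 = cycle_c].
Proof.
move=> n2; have [[j [k [l [jn kn ln cE]]]] cub] := cycle_c_max n2.
have ck : cycleS j k ^+ 2 <= cycle_c.
  by apply: cub; exists j, k, k; rewrite expr2.
have cl : cycleS j l ^+ 2 <= cycle_c.
  by apply: cub; exists j, l, l; rewrite expr2.
have [kl|lk] := leP (cycleS j l ^+ 2) (cycleS j k ^+ 2).
  exists j, k; split => //; apply/eqP; rewrite eq_le ck /= cE; nra.
exists j, l; split => //; apply/eqP; rewrite eq_le cl /= cE; nra.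
Qed.

Lemma cycle_Delta_min : (1 <= n)%N ->
  cycle_gaps cycle_Delta /\ lbound cycle_gaps cycle_Delta.
Proof.
move=> n1.
pose D (m t : int) : nat := `|(8 * m - (2 * t + 1) * n%:Z)%R|%N.
have DE m t : `|2 * pi * m%:~R / n%:R - (2 * t + 1)%:~R * pi / 4| =
              (D m t)%:R * (pi / (4 * n%:R)) :> R.
  have n0 : (n%:R : R) != 0 by rewrite pnatr_eq0 -lt0n.
  have q0 : 0 <= pi / (4 * n%:R) :> R.
    by rewrite divr_ge0 ?pi_ge0 ?mulr_ge0 ?ler0n.
  rewrite /D natr_absz -[X in _ = _ * X]ger0_norm // intr_norm -normrM.
  congr `| _ |; rewrite !(rmorphB, rmorphD, rmorphM) /= -pmulrn.
  by field.
have exD : exists d, `[< exists m t, D m t = d >].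
  by exists (D 0 0); apply/asboolP; exists 0, 0.
case: (ex_minnP exD) => d /asboolP[m [t Dd]] dmin.
pose x : R := d%:R * (pi / (4 * n%:R)).
have Gx : cycle_gaps x by exists m, t; rewrite DE Dd.
have Lx : lbound cycle_gaps x.
  move=> _ [m' [t' ->]]; rewrite DE ler_wpM2r //.
    by rewrite divr_ge0 ?pi_ge0 ?mulr_ge0 ?ler0n.
  by rewrite ler_nat; apply: dmin; apply/asboolP; exists m', t'.
suff -> : cycle_Delta = x by [].
apply/eqP; rewrite eq_le; apply/andP; split.
  by apply: ge_inf => //; exists x.
by apply: lb_le_inf => //; exists x.
Qed.

End CanonicalCycleBasis.

Arguments cycle_c : clear implicits.
Arguments cycle_Delta : clear implicits.
Arguments cycle_delta : clear implicits.

(* Main.v *)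
Require Import Defs.
From mathcomp Require Import all_boot all_order all_algebra.
From mathcomp Require Import all_classical all_reals all_analysis.
From mathcomp Require Import ring lra.

(** Everything rests on the identity [cycle_c R n = cos (cycle_Delta R n) ^+ 2].
    By a quarter turn, [S_j(k) = cos (2 pi m / n - pi / 4)] with [m = j k], and
    [cos ^+ 2] is even and has period [pi].  The points [(2 t + 1) pi / 4] with
    [t] even are the translates of [pi / 4] by multiples of [pi], those with
    [t] odd are the opposites of these; so the values [cos g ^+ 2], for [g] a
    gap [2 pi m / n - (2 t + 1) pi / 4], are exactly the numbers
    [cos (2 pi m / n - pi / 4) ^+ 2] for integer [m], and these are the
    [S_1(k) ^+ 2] by reduction of [m] modulo [n].  The gap closest to [0]
    maximises [cos ^+ 2]: [cycle_c_ge] and [cycle_c_le] are the two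
    inequalities.

    The rest is computation.  With a single nonzero [lambda_j = t], the diagonal
    entry [p_kk] is [(1 + 2 t S_j(k) ^+ 2) / n] and the sum of the [lambda_j] is
    [t].  Since [cos ^+ 2 Delta >= S_1(0) ^+ 2 = 1 / 2 > 0], the sign condition
    on [p_kk] can be solved for [t].  Below the threshold, [t = s - 1] put at a
    maximising pair makes that same entry negative. *)

Set Implicit Arguments.
Unset Strict Implicit.
Unset Printing Implicit Defensive.

Import Order.TTheory GRing.Theory Num.Theory.
Local Open Scope ring_scope.

Lemma cos_sqrDpiz (R : realType) (x : R) (u : int) :
  cos (x + u%:~R * pi) ^+ 2 = cos x ^+ 2.
Proof.
have cosDn (y : R) (k : nat) : cos (y + k%:R * pi) ^+ 2 = cos y ^+ 2.
  elim: k => [|k IHk]; first by rewrite mul0r addr0.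
  by rewrite -natr1 mulrDl mul1r addrA cosDpi sqrrN.
case: u => k; first exact: cosDn.
by rewrite -(cosDn (x + _) k.+1) NegzE mulrNz mulNr addrNK.
Qed.

(** Modulo [pi], [x] has a representative of absolute value at most [pi / 2];
    it is at distance at least [d] from [0], and [cos] is nonnegative and
    decreasing on [[0, pi / 2]]. *)
Lemma cos_sqr_le_dist (R : realType) (x d : R) : 0 <= d ->
  (forall u : int, d <= `|x - u%:~R * pi|) -> cos x ^+ 2 <= cos d ^+ 2.
Proof.
move=> d0 hd; have pi0 := pi_gt0 R.
pose u := Num.floor (x / pi + 1 / 2).
have /andP[u1 u2] := floor_itv (x / pi + 1 / 2); rewrite -/u in u1 u2.
have xE : x = x / pi * pi by rewrite divfK // gt_eqF.
have r2 : `|x - u%:~R * pi| <= pi / 2.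
  rewrite intrD in u2; rewrite ler_norml xE; apply/andP; split; nra.
have := hd u; rewrite -(cos_sqrDpiz x (- u)) mulrNz mulNr -cos_norm.
move: (normr_ge0 (x - u%:~R * pi)) r2; set r := `|_| => r0 r2 dr.
rewrite ler_sqr ?nnegrE.
- rewrite leNgt ltr_cos ?in_itv /= -?leNgt // ?r0 ?d0 /=; lra.
- by apply: cos_ge0_pihalf; lra.
- by apply: cos_ge0_pihalf; lra.
Qed.

Lemma cycleS_sqr (R : realType) (n j k : nat) :
  cycleS R n j k ^+ 2
  = cos (2 * pi * (j * k)%N%:~R / n%:R - pi / 4) ^+ 2.
Proof.
rewrite /cycleS -cosBpihalf; congr (cos _ ^+ 2).
rewrite -pmulrn natrM; lra.
Qed.

(** Reducing [m] modulo [n] changes the angle by a multiple of [2 pi], so one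
    frequency, [j = 1], already reaches every integer [m]. *)
Lemma cycle_c_ge (R : realType) (n : nat) (m : int) : (2 <= n)%N ->
  cos (2 * pi * m%:~R / n%:R - pi / 4) ^+ 2 <= cycle_c R n.
Proof.
move=> n2; have [_ cub] := cycle_c_max R n2.
have n0 : (n%:R : R) != 0 by rewrite pnatr_eq0 -lt0n ltnW.
have nz0 : (n%:Z : int) != 0 by rewrite -lt0n ltnW.
pose k := `|(m %% n%:Z)%Z|%N.
have kE : (m %% n%:Z)%Z = k%:Z by rewrite gez0_abs ?modz_ge0.
have kn : (k < n)%N by rewrite -ltz_nat -kE ltz_pmod // ltz_nat ltnW.
have -> : 2 * pi * m%:~R / n%:R - pi / 4
    = (2 * pi * (1 * k)%N%:~R / n%:R - pi / 4)
      + (2 * (m %/ n%:Z)%Z)%:~R * pi :> R.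
  rewrite mul1n {1}(divz_eq m n%:Z) kE intrD !intrM -!pmulrn.
  by field.
rewrite cos_sqrDpiz -cycleS_sqr; apply: cub.
by exists 1%N, k, k; rewrite expr2.
Qed.

Lemma cycle_c_le (R : realType) (n : nat) : (2 <= n)%N ->
  cycle_c R n <= cos (cycle_Delta R n) ^+ 2.
Proof.
move=> n2; have [[m [t DE]] Dlb] := cycle_Delta_min R (ltnW n2).
have [j [k [_ _ <-]]] := cycle_c_diag R n2.
rewrite cycleS_sqr; apply: cos_sqr_le_dist; first by rewrite DE.
move=> u; apply: Dlb; exists (j * k)%N%:Z, (2 * u).
congr `|_|; rewrite !(intrD, intrM) -!pmulrn; field.
by rewrite pnatr_eq0 -lt0n ltnW.
Qed.

Lemma cycle_c_cos (R : realType) (n : nat) : (2 <= n)%N ->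
  cycle_c R n = cos (cycle_Delta R n) ^+ 2.
Proof.
move=> n2; apply/eqP; rewrite eq_le cycle_c_le //=.
have [[m [t ->]] _] := cycle_Delta_min R (ltnW n2); rewrite cos_norm.
have n0 : (n%:R : R) != 0 by rewrite pnatr_eq0 -lt0n ltnW.
have tE : t = 2 * (t %/ 2)%Z + (t %% 2)%Z by rewrite mulrC -divz_eq.
move: (modz_ge0 t (isT : (2 : int) != 0)) (ltz_pmod t (isT : (0 : int) < 2)).
move: tE; case: (t %% 2)%Z => [[|[|//]]|//] tE _ _.
- (* [t] even: a translate of [2 pi m / n - pi / 4] by a multiple of [pi] *)
  apply: le_trans (cycle_c_ge R m n2).
  rewrite -(cos_sqrDpiz (2 * pi * m%:~R / n%:R - pi / 4) (- (t %/ 2)%Z)).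
  rewrite {1}tE !(intrD, intrM, mulrNz) -!pmulrn.
  by rewrite le_eqVlt; apply/orP; left; apply/eqP; congr (cos _ ^+ 2); field.
- (* [t] odd: the opposite of such a translate, for [- m] *)
  apply: le_trans (cycle_c_ge R (- m) n2).
  rewrite -(cos_sqrDpiz (2 * pi * (- m)%:~R / n%:R - pi / 4)
                        ((t %/ 2)%Z + 1)) -cosN.
  rewrite {1}tE !(intrD, intrM, mulrNz) -!pmulrn.
  by rewrite le_eqVlt; apply/orP; left; apply/eqP; congr (cos _ ^+ 2); field.
Qed.

(** [1 / 2] is [S_1(0) ^+ 2]. *)
Lemma cycle_c_ge_half (R : realType) (n : nat) : (2 <= n)%N ->
  1 / 2 <= cycle_c R n.
Proof.
move=> n2; apply: le_trans (cycle_c_ge R 0 n2).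
have := cos_mulr2n (- (pi / 4) : R).
rewrite mulr0 mul0r add0r.
have -> : (- (pi / 4)) *+ 2 = - (pi / 2) :> R by lra.
rewrite cosN cos_pihalf; lra.
Qed.

Lemma cycleP_diag (R : realType) (n : nat) (lam : nat -> R) (k : 'I_n) :
  cycleP n lam k k
  = 1 / n%:R * (1 + 2 * \sum_(1 <= j < n) lam j * cycleS R n j k ^+ 2).
Proof.
case: n k => [[]//|n] k.
have n0 : 0 <= n.+1%:R :> R by rewrite ler0n.
rewrite /cycleP /cycle_Lambda mul_mx_diag !mxE big_ord_recl !mxE /=.
rewrite mulr1 -expr2 exprVn sqr_sqrtr // big_add1 big_mkord mulrDr mulr1 div1r.
congr (_ + _); rewrite mulr_sumr mulr_sumr; apply: eq_bigr => j _.
rewrite !mxE /= /bump /= add1n.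
set s := Num.sqrt _; have s2 : s * s = 2 / n.+1%:R.
  by rewrite -expr2 sqr_sqrtr // divr_ge0.
transitivity (s * s * (lam j.+1 * cycleS R n.+1 j.+1 k ^+ 2)); first by ring.
by rewrite s2; ring.
Qed.

Lemma sum_nat_only (V : nmodType) (m n i : nat) (F : nat -> V) :
  (m <= i < n)%N -> (forall j, (m <= j < n)%N -> j <> i -> F j = 0) ->
  \sum_(m <= j < n) F j = F i.
Proof.
move=> iP F0; rewrite (bigD1_seq i) ?mem_index_iota ?iota_uniq //=.
rewrite big_seq_cond big1 ?addr0 // => j /andP[].
by rewrite mem_index_iota => jP /eqP; exact: F0.
Qed.

Theorem proposition4 (R : realType) (n : nat) (hn : (2 <= n)%N) :
  (forall (jstar : nat) (kstar : 'I_n) (t : R) (lam : nat -> R),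
     (1 <= jstar < n)%N ->
     cycleS R n jstar kstar ^+ 2 = cycle_c R n ->
     t < 0 ->
     lam jstar = t ->
     (forall j : nat, (1 <= j < n)%N -> j <> jstar -> lam j = 0) ->
     [/\ cycleP n lam kstar kstar
           = 1 / n%:R * (1 + 2 * t * cos (cycle_Delta R n) ^+ 2),
         0 <= cycleP n lam kstar kstar <->
           - (1 / (2 * cos (cycle_Delta R n) ^+ 2)) <= t
       & 0 <= cycleP n lam kstar kstar <->
           cycle_delta R n <= 1 + \sum_(1 <= j < n) lam j])
  /\
  (forall s : R, s < cycle_delta R n ->
     exists lam : nat -> R,
       [/\ forall j : nat, (1 <= j < n)%N -> lam j <= 0,
           1 + \sum_(1 <= j < n) lam j = s
         & exists k l : 'I_n, cycleP n lam k l < 0]).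
Proof.
rewrite /cycle_delta -cycle_c_cos //.
have c0 : 0 < cycle_c R n by apply: lt_le_trans (cycle_c_ge_half R hn); lra.
have n0 : 0 < 1 / n%:R :> R by rewrite divr_gt0 // ltr0n ltnW.
have h0 : 0 < 1 / (2 * cycle_c R n) by rewrite divr_gt0 // mulr_gt0.
have first_part (jstar : nat) (kstar : 'I_n) (t : R) (lam : nat -> R) :
     (1 <= jstar < n)%N ->
     cycleS R n jstar kstar ^+ 2 = cycle_c R n ->
     lam jstar = t ->
     (forall j : nat, (1 <= j < n)%N -> j <> jstar -> lam j = 0) ->
     [/\ cycleP n lam kstar kstar = 1 / n%:R * (1 + 2 * t * cycle_c R n),
         0 <= cycleP n lam kstar kstar <-> - (1 / (2 * cycle_c R n)) <= t
       & 0 <= cycleP n lam kstar kstar <->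
           1 - 1 / (2 * cycle_c R n) <= 1 + \sum_(1 <= j < n) lam j].
  move=> jP cE lamj lam0.
  have pE : cycleP n lam kstar kstar = 1 / n%:R * (1 + 2 * t * cycle_c R n).
    rewrite cycleP_diag (sum_nat_only jP) ?cE ?lamj ?mulrA //.
    by move=> j jn /(lam0 _ jn) ->; rewrite mul0r.
  have nonneg : 0 <= cycleP n lam kstar kstar <->
                - (1 / (2 * cycle_c R n)) <= t.
    rewrite pE pmulr_rge0 // -mulNr ler_pdivrMr ?mulr_gt0 //.
    by split; lra.
  split=> //; rewrite (sum_nat_only jP lam0) lamj lerD2l; exact: nonneg.
split=> [jstar kstar t lam jP cE _|s sd]; first exact: first_part.
have [j [k [jP kn cE]]] := cycle_c_diag R hn.
pose lam i := if i == j then s - 1 else 0.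
have lamj : lam j = s - 1 by rewrite /lam eqxx.
have lam0 i : (1 <= i < n)%N -> i <> j -> lam i = 0.
  by move=> _ /eqP/negbTE; rewrite /lam => ->.
exists lam; split.
- by move=> i _; rewrite /lam; case: ifP => // _; lra.
- by rewrite (sum_nat_only jP lam0) lamj; lra.
- exists (Ordinal kn), (Ordinal kn).
  have [_ _ nonneg] := first_part j (Ordinal kn) _ lam jP cE lamj lam0.
  rewrite ltNge; apply/negP => /nonneg.
  by rewrite (sum_nat_only jP lam0) lamj; lra.
Qed.
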